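(* Let $\mathbf A\in\mathbb F^{I\times R}$, $\mathbf B\in\mathbb F^{J\times R}$, $\mathbf C\in\mathbb F^{K\times R}$, $\bar{\mathbf A}\in\mathbb F^{I\times R}$, $\bar{\mathbf B}\in\mathbb F^{J\times R}$, and suppose $$\mathcal T=[\mathbf A,\mathbf B,\mathbf C]_R=[\bar{\mathbf A},\bar{\mathbf B},\mathbf C\mathbf\Pi\mathbf\Lambda_{\mathbf C}]_R,$$ where $\mathbf\Pi$ is an $R\times R$ permutation matrix and $\mathbf\Lambda_{\mathbf C}$ is a nonsingular $R\times R$ diagonal matrix. Suppose that $$\max\bigl(\min(k_{\mathbf A},k_{\mathbf B}-1),\ \min(k_{\mathbf A}-1,k_{\mathbf B})\bigr)+k_{\mathbf C}\ge R+1.$$ Then there exist nonsingular diagonal matrices $\mathbf\Lambda_{\mathbf A}$ and $\mathbf\Lambda_{\mathbf B}$ such that $$\bar{\mathbf A}=\mathbf A\mathbf\Pi\mathbf\Lambda_{\mathbf A},\qquad \bar{\mathbf B}=\mathbf B\mathbf\Pi\mathbf\Lambda_{\mathbf B},\qquad \mathbf\Lambda_{\mathbf A}\mathbf\Lambda_{\mathbf B}\mathbf\Lambda_{\mathbf C}=\mathbf I_R.$$ ($R$ is not assumed to be the rank of $\mathcal T$.)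
   Context: $\mathbb F$ is $\mathbb R$ or $\mathbb C$. For matrices $\mathbf A=[\mathbf a_1\cdots\mathbf a_R]\in\mathbb F^{I\times R}$, $\mathbf B=[\mathbf b_1\cdots\mathbf b_R]\in\mathbb F^{J\times R}$, $\mathbf C=[\mathbf c_1\cdots\mathbf c_R]\in\mathbb F^{K\times R}$ with all columns nonzero, $[\mathbf A,\mathbf B,\mathbf C]_R:=\sum_{r=1}^R\mathbf a_r\circ\mathbf b_r\circ\mathbf c_r\in\mathbb F^{I\times J\times K}$, where $\circ$ is the outer product; such an expression is called a polyadic decomposition (PD), and all matrices appearing in a PD are understood to have nonzero columns. The $k$-rank $k_{\mathbf M}$ of a matrix $\mathbf M$ is the largest number $k$ such that every set of $k$ columns of $\mathbf M$ is linearly independent. *)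

(* Defs.v *)
From mathcomp Require Import all_boot all_order all_algebra all_fingroup.
From mathcomp Require Import complex reals.

Set Implicit Arguments.
Unset Strict Implicit.
Unset Printing Implicit Defensive.

Import GRing.Theory.
Local Open Scope ring_scope.

Notation tensor3 F I J K := {ffun 'I_I * 'I_J * 'I_K -> F}.

Definition outer3 (F : fieldType) (I J K : nat)
    (a : 'cV[F]_I) (b : 'cV[F]_J) (c : 'cV[F]_K) : tensor3 F I J K :=
  [ffun x => a x.1.1 0 * b x.1.2 0 * c x.2 0].

Definition polyadic (F : fieldType) (I J K R : nat)
    (A : 'M[F]_(I, R)) (B : 'M[F]_(J, R)) (C : 'M[F]_(K, R)) :
    tensor3 F I J K :=
  \sum_(r < R) outer3 (col r A) (col r B) (col r C).

Definition nonzero_cols (F : fieldType) (m R : nat) (M : 'M[F]_(m, R)) : Prop :=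
  forall r : 'I_R, col r M != 0.

Definition is_PD (F : fieldType) (I J K R : nat) (T : tensor3 F I J K)
    (A : 'M[F]_(I, R)) (B : 'M[F]_(J, R)) (C : 'M[F]_(K, R)) : Prop :=
  [/\ nonzero_cols A, nonzero_cols B, nonzero_cols C & T = polyadic A B C].

(* A set of columns is a set of column indices, so that a repeated column makes
   the family dependent.  The bound [k <= R] is needed: for [k > R] there is no
   set of [k] columns and the condition would hold vacuously. *)
Definition krank (F : fieldType) (m R : nat) (M : 'M[F]_(m, R)) : nat :=
  \max_(k < R.+1 |
        [forall S : {set 'I_R},
           (#|S| == k) ==> free [seq col r M | r in S]]) k.

(* Main.v *)
(* Undoing the permutation and the scaling of the third factor, both PDs have
   the third factor C, with first factors A, A~ and second factors B, B~; then
   A diag(fC) B^T = A~ diag(fC) B~^T for every row vector f.  Put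
   n = R - k_C + 1.  For a set S of n indices and r in S, some f has fC
   supported in S and equal to 1 at r.  If k_A, k_B >= n, both sides have rank
   the size of the support of fC, and comparing row spaces puts the r-th column
   of B~ in the span of the columns of B indexed by S.  If moreover k_B > n,
   letting S vary forces this column to be proportional to the r-th column of B;
   cancelling the independent columns of B then gives the proportionality of the
   columns of A and A~.  The other term of the maximum is the same argument with
   A and B exchanged. *)
Require Import Defs.
From mathcomp Require Import all_boot all_order all_algebra all_fingroup.
From mathcomp Require Import complex reals.
From mathcomp Require Import zify ring.

Set Implicit Arguments.
Unset Strict Implicit.
Unset Printing Implicit Defensive.

Import GRing.Theory.
Local Open Scope ring_scope.

(** * Index sets and coordinate projections *)

Lemma superset_card (T : finType) (S : {set T}) (k : nat) :
  (#|S| <= k <= #|T|)%N -> exists2 S' : {set T}, S \subset S' & #|S'| = k.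
Proof.
case/andP=> leSk lekT; elim: k leSk lekT => [|k IHk].
  by rewrite leqn0 => /eqP S0 _; exists S.
rewrite leq_eqVlt => /orP[/eqP S_k _|leSk ltkT]; first by exists S.
have [S' sSS' cS'] := IHk leSk (ltnW ltkT).
have : (0 < #|~: S'|)%N by rewrite cardsCs setCK cS' subn_gt0.
case/card_gt0P=> t; rewrite inE => tS'; exists (t |: S').
  exact: subset_trans sSS' (subsetUr _ _).
by rewrite cardsU1 tS' cS'.
Qed.

(** Multiplying by this projection restricts to the columns in [S] while keeping all [R] indices, so
    no submatrix has to be reindexed. *)
Definition coord_proj (F : fieldType) (R : nat) (S : {set 'I_R}) : 'M[F]_R :=
  diag_mx (\row_r (r \in S)%:R).

Lemma diag_mx_inv (F : fieldType) (R : nat) (d : 'rV[F]_R) :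
  (forall r, d 0 r != 0) ->
  diag_mx d *m diag_mx (\row_r (d 0 r)^-1) = 1%:M.
Proof.
move=> d0; rewrite mulmx_diag; apply/matrixP=> i j; rewrite !mxE.
by rewrite divff.
Qed.

Lemma diag_mul_proj (F : fieldType) (R : nat) (S : {set 'I_R}) (d : 'rV[F]_R) :
  (forall r, r \notin S -> d 0 r = 0) ->
  diag_mx d *m coord_proj F S = diag_mx d.
Proof.
move=> d0; rewrite mulmx_diag; congr diag_mx; apply/rowP=> r; rewrite !mxE.
by case: (boolP (r \in S)) => [_|/d0->]; rewrite ?mulr1 ?mulr0.
Qed.

Lemma proj_mul_col (F : fieldType) (R : nat) (S : {set 'I_R}) (z : 'cV[F]_R) :
  (forall r, r \notin S -> z r 0 = 0) -> coord_proj F S *m z = z.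
Proof.
move=> z0; apply/colP=> r; rewrite mul_diag_mx !mxE.
by case: (boolP (r \in S)) => [_|/z0->]; rewrite ?mul1r ?mulr0.
Qed.

(** * Linear algebra of the k-rank *)

Lemma krank_le (F : fieldType) (m R : nat) (M : 'M[F]_(m, R)) :
  (krank M <= R)%N.
Proof. by apply/bigmax_leqP => k _; rewrite -ltnS. Qed.

(** The value 0 is always admissible, so the maximum is attained by some admissible [k]. *)
Lemma krank_free (F : fieldType) (m R : nat) (M : 'M[F]_(m, R))
    (S : {set 'I_R}) :
  #|S| = krank M -> free [seq col r M | r in S].
Proof.
pose good := [pred k : 'I_R.+1 | [forall S : {set 'I_R},
           (#|S| == k :> nat) ==> free [seq col r M | r in S]]].
have good0 : (0 < #|good|)%N.
  apply/card_gt0P; exists ord0; apply/forallP=> X; apply/implyP.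
  rewrite cards_eq0 => /eqP->.
  by rewrite /image_mem enum_set0 nil_free.
have [k /forallP/(_ S)/implyP kP kE] :=
  eq_bigmax_cond (fun k : 'I_R.+1 => k : nat) good0.
by move=> cS; apply: kP; rewrite cS -kE.
Qed.

Lemma mulmx_sum_col (F : fieldType) (m n : nat) (M : 'M[F]_(m, n))
    (z : 'cV[F]_n) : M *m z = \sum_j z j 0 *: col j M.
Proof.
apply/colP=> i; rewrite mxE summxE; apply: eq_bigr => j _.
by rewrite !mxE mulrC.
Qed.

Lemma krank_inj (F : fieldType) (m R : nat) (M : 'M[F]_(m, R))
    (S : {set 'I_R}) (z : 'cV[F]_R) :
  (#|S| <= krank M)%N -> (forall r, r \notin S -> z r 0 = 0) ->
  M *m z = 0 -> z = 0.
Proof.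
(* Independence is known for sets of exactly [krank M] indices, so [S] is first enlarged to that
   size. *)
move=> leS z0 Mz; have [|S' sSS' cS'] := @superset_card _ S (krank M).
  by rewrite leS card_ord krank_le.
have z'0 r : r \notin S' -> z r 0 = 0.
  by move=> rS'; apply: z0; apply: contra rS'; apply: (subsetP sSS').
have /freeP frM : free [tuple of [seq col r M | r in S']] by exact: krank_free.
have /frM k0 : \sum_(i < #|S'|) z (enum_val i) 0 *:
    [tuple of [seq col r M | r in S']]`_i = 0.
  rewrite -[RHS]Mz mulmx_sum_col (bigID [in S']) /= [X in _ + X]big1 ?addr0.
    by rewrite [RHS]big_enum_val; apply: eq_bigr => i _; rewrite nth_image.
  by move=> r /z'0->; rewrite scale0r.
apply/colP=> r; rewrite [RHS]mxE; have [rS|/z'0//] := boolP (r \in S').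
by have := k0 (enum_rank_in rS r); rewrite enum_rankK_in.
Qed.

Lemma krank_dual (F : fieldType) (m R : nat) (M : 'M[F]_(m, R))
    (S : {set 'I_R}) :
  (#|S| <= krank M)%N ->
  exists U : 'M[F]_(R, m), U *m (M *m coord_proj F S) = coord_proj F S.
Proof.
move=> leS; suff /submxP[U UE] : (coord_proj F S <= M *m coord_proj F S)%MS.
  by exists U.
(* It suffices that the cokernel [N] of [M *m coord_proj F S] is killed by [coord_proj F S]. Each
   column of [coord_proj F S *m N] is supported in [S] and annihilated by [M], hence is zero. *)
rewrite submxE; apply/eqP/matrixP=> i j.
set N := cokermx _; have := mulmx_coker (M *m coord_proj F S).
rewrite -/N -mulmxA => MPN.
have /(congr1 (fun z : 'cV_R => z i 0)) : col j (coord_proj F S *m N) = 0.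
  apply: (krank_inj (M := M) leS); last by rewrite colE mulmxA MPN mul0mx.
  by move=> r rS; rewrite mxE mul_diag_mx !mxE (negPf rS) mul0r.
by rewrite !mxE.
Qed.

Lemma krank_dual_tr (F : fieldType) (m R : nat) (M : 'M[F]_(m, R))
    (S : {set 'I_R}) :
  (#|S| <= krank M)%N ->
  exists V : 'M[F]_(m, R), forall d : 'rV[F]_R,
    (forall r, r \notin S -> d 0 r = 0) ->
    diag_mx d *m M^T *m V = diag_mx d.
Proof.
move=> /krank_dual[U /(congr1 trmx)]; rewrite !trmx_mul tr_diag_mx => UE.
exists U^T => d /diag_mul_proj dP.
by rewrite -[in LHS]dP -!mulmxA [_ *m (M^T *m _)]mulmxA UE.
Qed.

(** The columns indexed by [r] and the complement of [S] are few enough to be independent, and [f]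
    is the member dual to column [r] of a dual system. Its values on the rest of [S] are left
    free. *)
Lemma krank_select (F : fieldType) (m R : nat) (M : 'M[F]_(m, R))
    (S : {set 'I_R}) (r : 'I_R) :
  r \in S -> (#|~: S| < krank M)%N ->
  exists f : 'rV[F]_m, (f *m M) 0 r = 1 /\
    (forall s, s \notin S -> (f *m M) 0 s = 0).
Proof.
move=> rS ltS; have cr : (#|r |: ~: S| <= krank M)%N.
  by rewrite cardsU1 inE negbK rS.
have [U UE] := krank_dual cr; exists (row r U).
have fE s : s \in r |: ~: S -> (row r U *m M) 0 s = (r == s)%:R.
  move=> sS; have /matrixP/(_ r s) := UE.
  rewrite mulmxA mul_mx_diag [LHS]mxE [X in _ * X]mxE sS mulr1 => UM.
  by rewrite -row_mul mxE UM !mxE setU11.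
split=> [|s sS]; first by rewrite fE ?eqxx ?setU11.
rewrite fE; last by rewrite !inE sS orbT.
by case: eqP sS => // <-; rewrite rS.
Qed.

(** * Comparing two factorizations with the same diagonal part *)

(* Both products have the rank of [diag_mx d], so the row spaces of
   [diag_mx d *m Bt^T] and [diag_mx d *m B^T] coincide. *)
Lemma diag_factor_span (F : fieldType) (I J R : nat)
    (A At : 'M[F]_(I, R)) (B Bt : 'M[F]_(J, R)) (S : {set 'I_R})
    (d : 'rV[F]_R) (r : 'I_R) :
  (#|S| <= krank A)%N -> (#|S| <= krank B)%N ->
  (forall s, s \notin S -> d 0 s = 0) -> d 0 r = 1 ->
  A *m diag_mx d *m B^T = At *m diag_mx d *m Bt^T ->
  exists z : 'cV[F]_R, col r Bt = B *m z /\
    (forall s, s \notin S -> z s 0 = 0).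
Proof.
move=> /krank_dual[U UE] /krank_dual_tr[V VE] d0 dr; set D := diag_mx d => AB.
have PD : coord_proj F S *m D = D.
  by rewrite /D -[in RHS](diag_mul_proj d0) diag_mxC.
have UAD : U *m A *m D = D by rewrite -PD !mulmxA -[U *m A *m _]mulmxA UE.
have rkD : (\rank D <= \rank (A *m D *m B^T))%N.
  rewrite [X in (\rank X <= _)%N](_ : D = U *m (A *m D *m B^T) *m V); last first.
    by rewrite -!mulmxA [D *m _]mulmxA VE // mulmxA UAD.
  exact: leq_trans (mxrankM_maxl _ _) (mxrankM_maxr _ _).
have sub : (A *m D *m B^T <= D *m Bt^T)%MS by rewrite AB -mulmxA submxMl.
have : (D *m Bt^T <= A *m D *m B^T)%MS.
  rewrite -(geq_leqif (mxrank_leqif_sup sub)).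
  exact: leq_trans (mxrankM_maxl _ _) rkD.
case/submxP=> Y YE; exists (row r (Y *m A *m D))^T; split.
  have := congr1 (row r) YE; rewrite !mulmxA.
  have -> : row r (D *m Bt^T) = (col r Bt)^T.
    by apply/rowP=> j; rewrite mul_diag_mx !mxE dr mul1r.
  by move=> colE; apply: trmx_inj; rewrite colE trmx_mul trmxK -row_mul.
by move=> s sS; rewrite mul_mx_diag !mxE d0 ?mulr0.
Qed.

Lemma krank_uniq (F : fieldType) (m R : nat) (M : 'M[F]_(m, R))
    (S : {set 'I_R}) (y z : 'cV[F]_R) :
  (#|S| <= krank M)%N -> (forall r, r \notin S -> y r 0 = 0) ->
  (forall r, r \notin S -> z r 0 = 0) -> M *m y = M *m z -> y = z.
Proof.
move=> leS y0 z0 eqM; apply/eqP; rewrite -subr_eq0; apply/eqP.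
apply: (krank_inj (M := M) leS); last by rewrite mulmxBr eqM subrr.
by move=> r rS; rewrite !mxE y0 ?z0 ?subr0.
Qed.

Lemma contracted_uniq (F : fieldType) (I J K R : nat)
    (A At : 'M[F]_(I, R)) (B Bt : 'M[F]_(J, R)) (C : 'M[F]_(K, R)) :
  nonzero_cols A ->
  (R + 1 <= minn (krank A) (krank B - 1) + krank C)%N ->
  (forall f : 'rV[F]_K, A *m diag_mx (f *m C) *m B^T =
                        At *m diag_mx (f *m C) *m Bt^T) ->
  exists b c : 'rV[F]_R, [/\ diag_mx b *m diag_mx c = 1%:M,
    At = A *m diag_mx b & Bt = B *m diag_mx c].
Proof.
move=> A0 hk eqf; have leB := krank_le B; have leC := krank_le C.
(* The least size of [S] for which the complement has fewer than [krank C] elements, as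
   [krank_select] demands. *)
pose n := (R - krank C).+1.
have nA : (n <= krank A)%N by rewrite /n; lia.
have nB : (n < krank B)%N by rewrite /n; lia.
have cS (S : {set 'I_R}) : #|S| = n -> (#|~: S| < krank C)%N.
  by move=> Sn; rewrite cardsCs setCK Sn card_ord /n; lia.
have span (S : {set 'I_R}) r : #|S| = n -> r \in S ->
    exists z : 'cV[F]_R, col r Bt = B *m z /\
      (forall s, s \notin S -> z s 0 = 0).
  move=> Sn rS; have [f [fr f0]] := krank_select rS (cS _ Sn).
  by apply: (diag_factor_span _ _ f0 fr (eqf f)); lia.
have ex r : exists2 S : {set 'I_R}, r \in S & #|S| = n.
  have [|S sS Sn] := @superset_card _ [set r] n.
    by rewrite cards1 card_ord; lia.
  by exists S; rewrite // -sub1set.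
(* Exchanging [s] for some [t] outside [S] keeps the two supports inside a set
   of at most [krank B] indices, so both expansions are the same. *)
have prop r : exists b, col r Bt = b *: col r B.
  have [S rS Sn] := ex r; have [z [zE z0]] := span S r Sn rS.
  have zr s : s != r -> z s 0 = 0.
    move=> sr; have [sS|/z0//] := boolP (s \in S).
    (* A spare index exists because [n < krank B <= R]. *)
    have : (0 < #|~: S|)%N by rewrite cardsCs setCK Sn card_ord; lia.
    case/card_gt0P=> t; rewrite inE => tS.
    pose S' := t |: S :\ s.
    have S'n : #|S'| = n.
      rewrite cardsU1 !inE (negPf tS) andbF /=.
      by have := cardsD1 s S; rewrite sS Sn.
    have rS' : r \in S' by rewrite !inE [r == s]eq_sym sr rS orbT.
    have [y [yE y0]] := span S' r S'n rS'.
    have -> : z = y.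
      apply: (krank_uniq (M := B) (S := t |: S)); last by rewrite -zE -yE.
      - by rewrite cardsU1 tS Sn.
      - by move=> u; rewrite !inE negb_or => /andP[_ /z0].
      move=> u; rewrite !inE negb_or => /andP[ut uS]; apply: y0.
      by rewrite !inE (negPf ut) (negPf uS) andbF.
    apply: y0; rewrite !inE eqxx orbF; apply: contra tS => /eqP<-; exact: sS.
  exists (z r 0); rewrite zE mulmx_sum_col (bigD1 r) //= big1 ?addr0 //.
  by move=> s /zr->; rewrite scale0r.
have [b bE] : exists b : 'rV[F]_R, Bt = B *m diag_mx b.
  have [b bP] := fin_all_exists prop; exists (\row_r b r).
  apply/matrixP=> j r; rewrite mul_mx_diag !mxE.
  by have /colP/(_ j) := bP r; rewrite !mxE mulrC.
have AE : A = At *m diag_mx b.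
  apply/matrixP=> i r; have [S rS Sn] := ex r.
  have [f [fr f0]] := krank_select rS (cS _ Sn).
  have [|V VE] := @krank_dual_tr _ _ _ B S; first by lia.
  set D := diag_mx (f *m C).
  (* [V] cancels [B^T] on the support of [D]; in column [r], where [D] has entry 1, the two columns
     can then be compared. *)
  have : A *m (D *m B^T *m V) = At *m diag_mx b *m (D *m B^T *m V).
    rewrite !mulmxA eqf bE trmx_mul tr_diag_mx !mulmxA.
    by rewrite -[At *m D *m _]mulmxA [D *m _]diag_mxC !mulmxA.
  rewrite VE // => /matrixP/(_ i r); rewrite !mul_mx_diag [LHS]mxE [RHS]mxE.
  by rewrite fr !mulr1.
have b0 r : b 0 r != 0.
  apply: contra (A0 r) => /eqP br.
  by apply/eqP/colP=> i; rewrite mxE AE mul_mx_diag !mxE br mulr0.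
exists (\row_r (b 0 r)^-1), b; split=> //; rewrite ?[in RHS]AE.
  by rewrite diag_mxC diag_mx_inv.
by rewrite -mulmxA diag_mx_inv // mulmx1.
Qed.

(** * Contraction along the third mode, and the main result *)

Lemma polyadic_contract (F : fieldType) (I J K R : nat)
    (A : 'M[F]_(I, R)) (B : 'M[F]_(J, R)) (C : 'M[F]_(K, R)) (f : 'rV[F]_K) :
  A *m diag_mx (f *m C) *m B^T =
  \matrix_(i, j) \sum_k f 0 k * polyadic A B C (i, j, k).
Proof.
apply/matrixP=> i j; rewrite mul_mx_diag !mxE.
under [RHS]eq_bigr => k _ do rewrite sum_ffunE big_distrr /=.
rewrite exchange_big; apply: eq_bigr => r _.
rewrite !mxE mulr_sumr mulr_suml; apply: eq_bigr => k _.
by rewrite ffunE !mxE /=; ring.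
Qed.

Lemma diag_mx_perm (F : fieldType) (R : nat) (s : 'S_R) (g : 'rV[F]_R) :
  diag_mx (g *m perm_mx s) = (perm_mx s)^T *m diag_mx g *m perm_mx s.
Proof.
rewrite tr_perm_mx -row_permE -{1 3}[s]invgK -!col_permE.
by apply/matrixP=> i j; rewrite !mxE (inj_eq perm_inj); case: eqP => // ->.
Qed.

Lemma diag_mx_mul (F : fieldType) (R : nat) (g d : 'rV[F]_R) :
  diag_mx (g *m diag_mx d) = diag_mx g *m diag_mx d.
Proof.
by rewrite mulmx_diag mul_mx_diag; congr diag_mx; apply/rowP=> i; rewrite !mxE.
Qed.

Theorem proposition1p20 (RR : realType) (F : fieldType)
    (hF : F = (RR : fieldType) \/ F = (RR[i]%C : fieldType))
    (I J K R : nat) (T : tensor3 F I J K)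
    (A Abar : 'M[F]_(I, R)) (B Bbar : 'M[F]_(J, R)) (C : 'M[F]_(K, R))
    (Pi LC : 'M[F]_R)
    (hPi : is_perm_mx Pi) (hLC : is_diag_mx LC) (hLCu : LC \in unitmx)
    (hT : is_PD T A B C)
    (hTbar : is_PD T Abar Bbar (C *m Pi *m LC))
    (hk : (R + 1 <= maxn (minn (krank A) (krank B - 1))
                         (minn (krank A - 1) (krank B)) + krank C)%N) :
  exists LA LB : 'M[F]_R,
    [/\ is_diag_mx LA /\ LA \in unitmx,
        is_diag_mx LB /\ LB \in unitmx,
        Abar = A *m Pi *m LA,
        Bbar = B *m Pi *m LB &
        LA *m LB *m LC = 1%:M].
Proof.
have [A0 B0 _ TE] := hT; have [_ _ _ TbarE] := hTbar.
have /is_perm_mxP[s PiE] := hPi; have /diag_mxP[d LCE] := hLC.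
have PPt : Pi *m Pi^T = 1%:M by rewrite PiE tr_perm_mx -perm_mxM mulgV perm_mx1.
have PtP : Pi^T *m Pi = 1%:M by rewrite PiE tr_perm_mx -perm_mxM mulVg perm_mx1.
(* The scaling [LC] is absorbed entirely into the second factor, so that the third factor becomes
   [C]. *)
pose At := Abar *m Pi^T; pose Bt := Bbar *m LC *m Pi^T.
have eqf f : A *m diag_mx (f *m C) *m B^T = At *m diag_mx (f *m C) *m Bt^T.
  (* The contraction with [f] depends only on the tensor, hence agrees for both PDs. *)
  rewrite polyadic_contract -TE TbarE -polyadic_contract !mulmxA.
  rewrite LCE diag_mx_mul PiE diag_mx_perm -PiE -LCE.
  by rewrite /At /Bt !trmx_mul trmxK LCE tr_diag_mx !mulmxA.
have eqf' f : B *m diag_mx (f *m C) *m A^T = Bt *m diag_mx (f *m C) *m At^T.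
  have /(congr1 trmx) := eqf f.
  by rewrite !trmx_mul !trmxK !tr_diag_mx !mulmxA.
have [b [c [bc AtE BtE]]] : exists b c : 'rV[F]_R,
    [/\ diag_mx b *m diag_mx c = 1%:M, At = A *m diag_mx b
      & Bt = B *m diag_mx c].
  have [hAB|hBA] : (R + 1 <= minn (krank A) (krank B - 1) + krank C)%N \/
      (R + 1 <= minn (krank B) (krank A - 1) + krank C)%N by lia.
    exact: contracted_uniq A0 hAB eqf.
  have [c [b [cb BtE AtE]]] := contracted_uniq B0 hBA eqf'.
  by exists b, c; rewrite diag_mxC.
have d0 r : d 0 r != 0.
  move: hLCu; rewrite LCE unitmxE det_diag unitfE.
  by move/prodf_neq0; apply.
pose LCi := diag_mx (\row_r (d 0 r)^-1).
have LCV : LC *m LCi = 1%:M by rewrite LCE diag_mx_inv.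
have LVC : LCi *m LC = 1%:M by rewrite LCE diag_mxC diag_mx_inv.
(* Conjugation by [Pi] moves the scalings past the permutation; [LCi] undoes the factor [LC] put
   into [Bt]. *)
pose LA := Pi^T *m diag_mx b *m Pi; pose LB := Pi^T *m diag_mx c *m Pi *m LCi.
have LAB : LA *m LB *m LC = 1%:M.
  rewrite /LA /LB -!mulmxA LVC mulmx1 (mulmxA Pi) PPt mul1mx.
  by rewrite (mulmxA (diag_mx b)) bc mul1mx.
have [LAu LBCu] := mulmx1_unit (etrans (mulmxA LA LB LC) LAB).
exists LA, LB; split=> //.
- split=> //; by rewrite /LA PiE -diag_mx_perm diag_mx_is_diag.
- split; last by move: LBCu; rewrite unitmx_mul => /andP[].
  by rewrite /LB PiE -diag_mx_perm /LCi -diag_mx_mul diag_mx_is_diag.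
- by rewrite /LA !mulmxA -(mulmxA A) PPt mulmx1 -AtE /At -mulmxA PtP mulmx1.
rewrite /LB !mulmxA -(mulmxA B) PPt mulmx1 -BtE /Bt.
by rewrite -(mulmxA _ Pi^T) PtP mulmx1 -mulmxA LCV mulmx1.
Qed.
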